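(* Let $H_0$ be a vector space (real or complex) with an indefinite inner product $\{\cdot,\cdot\}_0$, let $U_0$ be a $\{\cdot,\cdot\}_0$-unitary operator (bounded or not), and let $x_0\in H_0$. Let $H$ be a separable Hilbert space over the same scalar field with an orthonormal basis $\{b_n\}_{n\in\mathbb Z}$. Choose nonzero scalars $u_n$ $(n\in\mathbb Z)$ so that $$\overline{u_{-n}}=u_n\quad(n\in\mathbb Z)\qquad\text{and}\qquad \Bigl\{\tfrac1{u_N}\{x_0,U_0^Nx_0\}_0\Bigr\}_{N\in\mathbb Z}\in \ell_2(\mathbb Z)$$ (this is always possible), and put $$f_0(N)=\frac12\,\frac{\overline{u_0}}{\overline{u_N}}\;\overline{\{x_0,U_0^Nx_0\}_0}\qquad(N\in\mathbb Z).$$ Then $\{f_0(N)\}_{N\in\mathbb Z}\in\ell_2(\mathbb Z)$, and if one defines $f_0=\sum_{n\in\mathbb Z}f_0(n)b_n\in H$ and $x_1:=b_0\oplus f_0\in H\oplus H$, then $$\{x_1,U_1^Nx_1\}_1=\{x_0,U_0^Nx_0\}_0\qquad\text{for all }N\in\mathbb Z,$$ where $U_1=U\oplus (U^* )^{-1}$ on $H\oplus H$, $U$ is the bilateral weighted shift (bounded or not) generated by $Ub_n=\frac{u_{n+1}}{u_n}b_{n+1}$, and $\{x\oplus y,x'\oplus y'\}_1=(x,y')+(y,x')$.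
   Context: An indefinite inner product is a Hermitian sesquilinear form, not assumed positive. All sesquilinear forms, including the Hilbert scalar product $(\cdot,\cdot)$, are linear in the second argument. $U_0$ being $\{\cdot,\cdot\}_0$-unitary means that $U_0$ is linear and injective, all powers $U_0^N$ $(N\in\mathbb Z)$ exist, and $\{U_0x,U_0y\}_0=\{x,y\}_0=\{U_0^{-1}x,U_0^{-1}y\}_0$, at least for $x,y\in\mathrm{span}\{U_0^Nx_0:N\in\mathbb Z\}$. $U$ is the closure of the linear operator defined on $\mathrm{span}\{b_n\}$ by the formula above; the actions of $U^N$ and $(U^* )^{-N}$ are generated by $U^N b_n=\frac{u_{n+N}}{u_n}b_{n+N}$ and $(U^* )^{-N}b_n=\frac{\overline{u_n}}{\overline{u_{n+N}}}b_{n+N}$, and $U_1^N=U^N\oplus(U^* )^{-N}$.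
   Formalization: For some admissible u_n, x_1 is not in the domain of U_1^N; the identity is proved literally when it is, and for all u_n and N with the left side evaluated through the action of U_1^N on the basis vectors; weights with x_1 in every domain are shown to exist. *)

(* Defs.v *)
From HB Require Import structures.
From mathcomp Require Import all_boot all_order all_algebra finmap complex.
From mathcomp Require Import all_classical all_reals all_analysis.
From mathcomp.analysis.showcase Require summability.

Set Implicit Arguments.
Unset Strict Implicit.
Unset Printing Implicit Defensive.

Import Order.TTheory GRing.Theory Num.Theory.
Import numFieldNormedType.Exports.

Local Open Scope classical_set_scope.
Local Open Scope ring_scope.

(** ** Scalars: the reals or the complex numbers *)

Inductive scalar_kind := RealScalars | ComplexScalars.

Definition RorC (R : realType) (k : scalar_kind) : numFieldType :=
  match k with RealScalars => R | ComplexScalars => R[i] end.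

Definition sconj {R : realType} {k : scalar_kind} : RorC R k -> RorC R k :=
  match k return RorC R k -> RorC R k with
  | RealScalars => fun x => x
  | ComplexScalars => fun x => conjc x
  end.

(** ** Sesquilinear forms *)

(* MathComp's forms are linear in the first argument and conjugate-linear in
   the second one; here they are linear in the second argument, whence the
   swap. *)
Definition ip {K : numFieldType} {V : Type} (B : V -> V -> K) (x y : V) : K :=
  B y x.

(* {x (+) y, x' (+) y'}_1 = (x, y') + (y, x') *)
Definition cross_ip {K : numFieldType} {V : Type} (B : V -> V -> K)
    (x y : V * V) : K :=
  ip B x.1 y.2 + ip B x.2 y.1.

Definition dsum_ip {K : numFieldType} {V : Type} (B : V -> V -> K)
    (x y : V * V) : K :=
  ip B x.1 y.1 + ip B x.2 y.2.

(** ** Unordered sums and bases *)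

Definition has_sum {I : choiceType} {K : numFieldType} {V : normedModType K}
    (f : I -> V) (s : V) : Prop :=
  summability.partial_sum f @ summability.totally --> s.

Definition unordered_sum {I : choiceType} {K : numFieldType}
    {V : normedModType K} (f : I -> V) : V :=
  summability.sum f.

Definition ell2 {I : choiceType} {K : numFieldType} (a : I -> K) : Prop :=
  exists s : K^o, has_sum (fun i => `|a i| ^+ 2 : K^o) s.

Definition lin_span {I : choiceType} {K : numFieldType} {V : lmodType K}
    (v : I -> V) : set V :=
  [set x | exists (J : {fset I}) (a : I -> K), x = \sum_(i <- J) a i *: v i].

Definition orthonormal_basis {I : choiceType} {K : numFieldType}
    {V : normedModType K} (B : V -> V -> K) (b : I -> V) : Prop :=
  (forall i j, ip B (b i) (b j) = (i == j)%:R)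
  /\ closure (lin_span b) = [set: V].

(** ** Possibly unbounded, partially defined operators, given by their graph *)

Definition is_operator {K : numFieldType} {V W : lmodType K}
    (A : set (V * W)) : Prop :=
  [/\ A (0, 0),
      forall (a : K) p q, A p -> A q -> A (a *: p + q)
    & forall x y z, A (x, y) -> A (x, z) -> y = z].

Definition op_injective {V W : Type} (A : set (V * W)) : Prop :=
  forall x y z, A (x, z) -> A (y, z) -> x = y.

Definition dom {V W : Type} (A : set (V * W)) : set V :=
  [set x | exists y, A (x, y)].

(* The value [A x], with junk value 0 if [x] is not in the domain of [A]. *)
Definition app {K : numFieldType} {V W : lmodType K}
    (A : set (V * W)) (x : V) : W :=
  xget 0 [set y | A (x, y)].

(* Integer powers of the graph, on their natural (maximal) domains. *)
Definition op_pow {V : Type} (A : set (V * V)) (N : int) : set (V * V) :=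
  match N with
  | Posz n => iter n (fun B => (A \; B)%relation) diagonal
  | Negz n => iter n.+1 (fun B => (A^-1 \; B)%relation) diagonal
  end.

Definition op_dsum {V W V' W' : Type} (A : set (V * W)) (B : set (V' * W')) :
    set ((V * V') * (W * W')) :=
  [set p | A (p.1.1, p.2.1) /\ B (p.1.2, p.2.2)].

Definition adjoint {K : numFieldType} {V : Type} (B : V -> V -> K)
    (A : set (V * V)) : set (V * V) :=
  [set p | forall x y, A (x, y) -> ip B p.1 y = ip B p.2 x].

Definition unitary_on_orbit {K : numFieldType} {V : lmodType K}
    (B : V -> V -> K) (A : set (V * V)) (x0 : V) : Prop :=
  [/\ is_operator A, op_injective A,
      forall N : int, dom (op_pow A N) x0
    & forall x y, lin_span (fun N : int => app (op_pow A N) x0) x ->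
        lin_span (fun N : int => app (op_pow A N) x0) y ->
        ip B (app A x) (app A y) = ip B x y
        /\ ip B x y = ip B (app (A^-1)%relation x) (app (A^-1)%relation y)].

(** ** The weighted shift and its double *)

(* The span is taken in the product space, so it is the graph of the linear
   operator defined on [lin_span b] by b_n |-> (u_(n+1) / u_n) b_(n+1). *)
Definition wshift {K : numFieldType} {V : normedModType K}
    (b : int -> V) (u : int -> K) : set (V * V) :=
  closure (lin_span (fun n : int => (b n, (u (n + 1) / u n) *: b (n + 1)))).

Definition double_shift {K : numFieldType} {V : normedModType K}
    (B : V -> V -> K) (b : int -> V) (u : int -> K) :
    set ((V * V) * (V * V)) :=
  op_dsum (wshift b u) ((adjoint B (wshift b u))^-1)%relation.

Definition dsum_basis {V : zmodType} {I : Type} (b : I -> V) (i : I + I) :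
    V * V :=
  match i with inl n => (b n, 0) | inr n => (0, b n) end.

(* [{x, A x}_1] evaluated through the action of [A] on the basis vectors,
     {x, A x}_1 = \sum_i (e_i, x) {x, A e_i}_1,
   where (e_i)_i is the orthonormal basis of V (+) V made of the b_n (+) 0 and
   the 0 (+) b_n. Unlike [cross_ip B x (app A x)], this is meaningful even when
   [x] is not in the domain of [A]. *)
Definition cross_ip_via_basis {K : numFieldType} {V : normedModType K}
    (B : V -> V -> K) (b : int -> V) (A : set ((V * V) * (V * V)))
    (x : V * V) (s : K) : Prop :=
  (forall i : int + int, dom A (dsum_basis b i))
  /\ has_sum (fun i : int + int =>
       dsum_ip B (dsum_basis b i) x * cross_ip B x (app A (dsum_basis b i))
         : K^o) (s : K^o).

(** ** The data attached to a sequence of weights *)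

Definition admissible_weights {R : realType} {k : scalar_kind}
    (c u : int -> RorC R k) : Prop :=
  [/\ forall n, u n != 0,
      forall n, sconj (u (- n)) = u n
    & ell2 (fun N => (u N)^-1 * c N)].

Definition f0_coef {R : realType} {k : scalar_kind} (c u : int -> RorC R k)
    (N : int) : RorC R k :=
  2%:R^-1 * (sconj (u 0) / sconj (u N)) * sconj (c N).

Definition f0_vec {R : realType} {k : scalar_kind}
    {V : normedModType (RorC R k)} (b : int -> V)
    (c u : int -> RorC R k) : V :=
  unordered_sum (fun n : int => f0_coef c u n *: b n).

(* Main.v *)
(* Unitarity of U_0 gives c(-N) = conj c(N) for c(N) = {x_0, U_0^N x_0}_0. The
   N-th power of U_1 maps b_0 (+) f_0 to a vector whose first component is
   (u_N / u_0) b_N and whose second component has b_0-coordinate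
   conj (u_{-N} / u_0) f_0(-N). Hence {x_1, U_1^N x_1}_1 has two terms, one
   equal to c(N) / 2 and the other to conj c(-N) / 2 = c(N) / 2. For unbounded
   U_1 the graphs are handled through coordinates: a graph closure or an adjoint
   only imposes linear relations between the coordinates of argument and value,
   because the coordinates are continuous (Cauchy-Schwarz), and coordinates
   determine a vector because the span of the basis is dense. *)
Require Import Defs.
From HB Require Import structures.
From mathcomp Require Import all_boot all_order all_algebra finmap complex.
From mathcomp Require Import all_classical all_reals all_analysis.
From mathcomp.analysis.showcase Require summability.
From mathcomp Require Import zify.

Set Implicit Arguments.
Unset Strict Implicit.
Unset Printing Implicit Defensive.

Import Order.TTheory GRing.Theory Num.Theory.
Import numFieldNormedType.Exports.

Local Open Scope classical_set_scope.
Local Open Scope ring_scope.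




#[local] Existing Instance summability.totally_filter.

(** * Unordered sums, closures and linear spans in normed spaces *)

Section UnorderedSums.
Context {I : choiceType} {K : numFieldType}.
Implicit Types (V W : normedModType K).

Lemma partial_sumE {V : zmodType} (f : I -> V) (J : {fset I}) :
  summability.partial_sum f J = \sum_(i <- J) f i.
Proof. by rewrite /summability.partial_sum big_seq_fsetE. Qed.

Lemma partial_sumB {V : zmodType} (f : I -> V) (J0 J : {fset I}) :
  (J0 `<=` J)%fset ->
  \sum_(i <- J) f i - \sum_(i <- J0) f i = \sum_(i <- (J `\` J0)%fset) f i.
Proof.
move=> /fsubsetP sJ; apply/eqP; rewrite subr_eq addrC; apply/eqP.
rewrite (bigID (mem J0)) /=; congr (_ + _); rewrite big_fset_condE /=;
  congr (bigop _ _ _); congr enum_fset; apply/fsetP => i; rewrite !inE /=.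
- by apply/andb_idl => /sJ.
- by rewrite andbC.
Qed.

Lemma has_sumP {V} (f : I -> V) (s : V) :
  has_sum f s <-> forall e, 0 < e -> exists J0 : {fset I},
    forall J : {fset I}, (J0 `<=` J)%fset -> `|s - \sum_(i <- J) f i| < e.
Proof.
rewrite /has_sum cvgrPdist_lt; split => h e /h.
- by case=> J0 _ hJ; exists J0 => J /hJ; rewrite /= partial_sumE.
- by case=> J0 hJ; exists J0 => // J /hJ; rewrite /= partial_sumE.
Qed.

(** In a complete space the partial sums converge once they are Cauchy, and [unordered_sum] is then
    their limit rather than an arbitrary point. *)
Lemma cauchy_has_sum {V : completeNormedModType K} (f : I -> V) :
  (forall e, 0 < e -> exists J0 : {fset I}, forall J : {fset I},
    (J0 `<=` J)%fset -> `|\sum_(i <- (J `\` J0)%fset) f i| < e) ->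
  has_sum f (unordered_sum f).
Proof.
move=> h; rewrite /has_sum /unordered_sum /summability.sum.
suff : cvg (summability.partial_sum f @ summability.totally) by [].
apply/cauchy_cvgP/cauchy_exP => e /h[J0 hJ].
exists (summability.partial_sum f J0); exists J0 => // J /= sJ.
by rewrite -ball_normE /= distrC !partial_sumE partial_sumB // hJ.
Qed.

Lemma has_sum_unique {V} (f : I -> V) (s t : V) :
  has_sum f s -> has_sum f t -> s = t.
Proof. by move=> fs ft; apply: (cvg_unique (@norm_hausdorff _ _) fs ft). Qed.

(** Used for scalar products with a fixed vector and for multiplication by a constant. *)
Lemma has_sum_bounded_additive {V W} (F : V -> W) (C : K) (f : I -> V) (s : V) :
  zmod_morphism F -> 0 <= C -> (forall x, `|F x| <= C * `|x|) ->
  has_sum f s -> has_sum (F \o f) (F s).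
Proof.
move=> FB C0 FC /has_sumP fs; apply/has_sumP => e e0.
have F0 : F 0 = 0 by rewrite -[in LHS](subrr 0) FB subrr.
have FD : {morph F : x y / x + y}.
  by move=> x y; rewrite -[y in LHS]opprK -[- y]sub0r !FB F0 sub0r opprK.
(* [C] may vanish, so the tolerance is [e / (C + 1)]. *)
have C1 : 0 < C + 1 by rewrite ltr_wpDl.
have [|J0 hJ] := fs (e / (C + 1)); first by rewrite divr_gt0.
exists J0 => J /hJ; rewrite ltr_pdivlMr //.
rewrite -(big_morph F FD F0) -FB; apply: le_lt_trans.
by apply: le_trans (FC _) _; rewrite mulrC ler_wpM2l // lerDl.
Qed.

Lemma has_sum_finite {V} (f : I -> V) (J0 : {fset I}) :
  (forall i, i \notin J0 -> f i = 0) -> has_sum f (\sum_(i <- J0) f i).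
Proof.
move=> f0; apply/has_sumP => e e0; exists J0 => J sJ.
rewrite distrC partial_sumB // big_seq big1 ?normr0 // => i.
by rewrite inE => /andP[/f0].
Qed.

Lemma closure_normP {V} (A : set V) (x : V) :
  closure A x <-> forall e, 0 < e -> exists2 y, A y & `|x - y| < e.
Proof.
split=> [cA e e0|h B /nbhs_normP[e /= e0 eB]].
  have [|y [Ay /= ?]] := cA [set y | `|x - y| < e]; last by exists y.
  by apply/nbhs_normP; exists e.
by have [y Ay xy] := h e e0; exists y; split=> //; apply: eB.
Qed.

(** A nonzero [F x] is contradicted by a point of [A] within |F x| / (C + 1) of [x]. This carries
    linear relations from a span to its closure. *)
Lemma closure_additive_eq0 {V W} (F : V -> W) (C : K) (A : set V) :
  zmod_morphism F -> 0 <= C -> (forall x, `|F x| <= C * `|x|) ->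
  (forall x, A x -> F x = 0) -> forall x, closure A x -> F x = 0.
Proof.
move=> FB C0 FC FA x /closure_normP cA; have [//|Fx0] := eqVneq (F x) 0.
have C1 : 0 < C + 1 by rewrite ltr_wpDl.
have [|y Ay] := cA (`|F x| / (C + 1)); first by rewrite divr_gt0 ?normr_gt0.
rewrite ltr_pdivlMr // => /lt_geF/negP[].
have -> : F x = F (x - y) by rewrite FB (FA y) // subr0.
by apply: le_trans (FC _) _; rewrite mulrC ler_wpM2l // lerDl.
Qed.

Definition submod_set {V : lmodType K} (A : set V) :=
  A 0 /\ forall (a : K) x y, A x -> A y -> A (a *: x + y).

Lemma submod_lin_span {V : lmodType K} (v : I -> V) : submod_set (lin_span v).
Proof.
(* Extending coefficients by 0 puts two combinations over the union of their supports. *)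
have widen (J J' : {fset I}) (a : I -> K) : (J `<=` J')%fset ->
    \sum_(i <- J) a i *: v i =
    \sum_(i <- J') (if i \in J then a i else 0) *: v i.
  move=> sJ; rewrite -(big_fset_incl _ sJ) => [|i _ /negPf ->];
    last by rewrite scale0r.
  by rewrite big_seq [RHS]big_seq; apply: eq_bigr => i ->.
split; first by exists fset0, (fun=> 0); rewrite big_seq_fset0.
move=> a _ _ [J1 [a1 ->]] [J2 [a2 ->]].
rewrite (widen _ _ _ (fsubsetUl J1 J2)) (widen _ _ _ (fsubsetUr J1 J2)).
rewrite scaler_sumr -big_split /=; exists (J1 `|` J2)%fset; eexists.
by apply: eq_bigr => i _; rewrite scalerA -scalerDl.
Qed.

Lemma mem_lin_span {V : lmodType K} (v : I -> V) i : lin_span v (v i).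
Proof. by exists [fset i]%fset, (fun=> 1); rewrite big_seq_fset1 scale1r. Qed.

Lemma submod_closure {V} (A : set V) : submod_set A -> submod_set (closure A).
Proof.
case=> A0 AP; split; first exact: subset_closure.
move=> a x y /closure_normP cx /closure_normP cy; apply/closure_normP => e e0.
have a1 : 0 < `|a| + 1 by rewrite ltr_wpDl.
have e2 : 0 < e / 2 by rewrite divr_gt0.
have [|x' Ax' hx] := cx (e / 2 / (`|a| + 1)); first by rewrite divr_gt0.
have [y' Ay' hy] := cy _ e2; exists (a *: x' + y'); first exact: AP.
rewrite opprD addrACA -scalerBr [e]splitr (le_lt_trans (ler_normD _ _)) //.
apply: ler_ltD hy; rewrite normrZ.
move: hx; rewrite ltr_pdivlMr // => /ltW; apply: le_trans.
by rewrite mulrC ler_wpM2l // lerDl.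
Qed.

End UnorderedSums.


(** * Conjugation and moduli, uniformly for real and complex scalars *)

Section ScalarConjugation.
Context {R : realType} {k : scalar_kind}.
Implicit Types a b : RorC R k.

Fact sconj_zmod_morphism : zmod_morphism (@sconj R k).
Proof. by case: k => //= x y; rewrite -rmorphB. Qed.

Fact sconj_monoid_morphism : monoid_morphism (@sconj R k).
Proof. by case: k => //=; split; [exact: rmorph1 | exact: rmorphM]. Qed.

HB.instance Definition _ :=
  GRing.isZmodMorphism.Build (RorC R k) (RorC R k) sconj sconj_zmod_morphism.
HB.instance Definition _ :=
  GRing.isMonoidMorphism.Build (RorC R k) (RorC R k) sconj
    sconj_monoid_morphism.

Lemma sconjK : involutive (@sconj R k).
Proof. by case: k => //=; exact: conjcK. Qed.

Lemma normCKs a : `|a| ^+ 2 = a * sconj a.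
Proof.
by case: k a => /= a; [rewrite real_normK ?num_real ?expr2 | exact: sqr_normc].
Qed.

Lemma norm_sconj a : `|sconj a| = `|a|.
Proof. by case: k a => //= a; exact: normcJ. Qed.

Lemma sconj_ge0 a : 0 <= a -> sconj a = a.
Proof.
case: k a => //= a; rewrite lecE /= => /andP[/eqP a0 _].
by case: a a0 => x y /= ->; rewrite oppr0.
Qed.

(** A positive complex number has zero imaginary part, so both cases reduce to the Archimedean
    property of [R]. *)
Lemma archi_lt1 a : 0 < a -> exists n : nat, (2 ^+ n)^-1 < a.
Proof.
suff arch (x : R) : 0 < x -> exists n : nat, (2 ^+ n)^-1 < x.
  case: k a => /= a; first exact: arch.
  rewrite ltcE => /andP[/eqP a0 /arch[n na]]; exists n.
  rewrite -[2]/(1 + 1) -(rmorph1 (real_complex R)) -rmorphD -rmorphXn -fmorphV.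
  by rewrite ltcE /= a0 eqxx.
move=> x0; exists (Num.bound x^-1).
by rewrite invf_plt ?posrE ?exprn_gt0 // upper_nthrootP.
Qed.

End ScalarConjugation.

(** * Coordinates with respect to an orthonormal basis *)

Section HilbertSpace.
Context {R : realType} {k : scalar_kind} {H : normedModType (RorC R k)}.
Context (dot : {dot H for (@sconj R k)}).
Hypothesis hnorm : forall x : H, `|x| ^+ 2 = ip dot x x.

Lemma dotC x y : dot x y = sconj (dot y x).
Proof. by rewrite [LHS](hermC dot) expr0 mul1r. Qed.

Lemma dotZl a x y : dot (a *: x) y = a * dot x y.
Proof. exact: linearZl_LR. Qed.

Lemma dotZr a x y : dot x (a *: y) = sconj a * dot x y.
Proof. by rewrite linearZr_LR. Qed.

(** Split x = z + a y with z orthogonal to y: then [dot x y] is a |y|^2, and Pythagoras gives |a|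
    |y| <= |x|. *)
Lemma dot_cauchy_schwarz x y : `|dot x y| <= `|x| * `|y|.
Proof.
have [->|y0] := eqVneq y 0; first by rewrite linear0r !normr0 mulr0.
have yy : dot y y = `|y| ^+ 2 by rewrite hnorm.
have ny0 : 0 < `|y| by rewrite normr_gt0.
have [a [z [-> zy]]] : exists a z, x = z + a *: y /\ dot z y = 0.
  exists (dot x y / `|y| ^+ 2), (x - (dot x y / `|y| ^+ 2) *: y).
  split; first by rewrite subrK.
  by rewrite linearBl /= dotZl yy divfK ?subrr // expf_neq0 // gt_eqF.
have yz : dot y z = 0 by rewrite dotC zy rmorph0.
have zz : dot (z + a *: y) (z + a *: y) = `|z| ^+ 2 + (`|a| * `|y|) ^+ 2.
  rewrite linearDl /= !linearDr /= !dotZl !dotZr zy yz yy.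
  by rewrite !mulr0 addr0 add0r exprMn normCKs (hnorm z) mulrA.
rewrite linearDl /= dotZl zy add0r yy normrM normrX normr_id.
rewrite expr2 mulrA ler_wpM2r // -(@ler_pXn2r _ 2) ?nnegrE ?mulr_ge0 //.
by rewrite [leRHS]hnorm /ip zz lerDr exprn_ge0.
Qed.

Context {I : choiceType} {b : I -> H}.
Hypothesis hb : orthonormal_basis dot b.

Lemma dot_basis i j : dot (b i) (b j) = (i == j)%:R.
Proof. by have [e _] := hb; rewrite -[LHS]/(ip dot (b j) (b i)) e eq_sym. Qed.

Lemma norm_basis i : `|b i| = 1.
Proof.
by apply/eqP; rewrite -(@eqrXn2 _ 2) // expr1n hnorm /ip dot_basis eqxx.
Qed.

(** The difference is orthogonal to the span of [b], hence, by density and continuity, to itself. *)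
Lemma coord_inj x y : (forall i, dot x (b i) = dot y (b i)) -> x = y.
Proof.
move=> xy; apply/subr0_eq.
have: closure (lin_span b) (x - y) by have [_ ->] := hb.
have: forall i, dot (x - y) (b i) = 0 by move=> i; rewrite linearBl /= xy subrr.
move: (x - y) => z zb cz; suff : dot z z = 0.
  rewrite -[dot z z]/(ip dot z z) -hnorm => /eqP.
  by rewrite expf_eq0 /= normr_eq0 => /eqP.
pose F x : (RorC R k)^o := dot x z.
apply: (@closure_additive_eq0 _ H _ F `|z| (lin_span b)) cz => //.
- by move=> u v; rewrite /F linearBl.
- by move=> u; rewrite /F mulrC dot_cauchy_schwarz.
- move=> _ [J [a ->]]; rewrite /F linear_sumlz big1 // => i _ /=.
  by rewrite dotZl dotC zb rmorph0 mulr0.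
Qed.

Lemma has_sum_dot {J : choiceType} (f : J -> H) (s y : H) : has_sum f s ->
  has_sum (fun i => dot (f i) y : (RorC R k)^o) (dot s y : (RorC R k)^o).
Proof.
move=> fs; pose F x : (RorC R k)^o := dot x y.
apply: (@has_sum_bounded_additive _ _ _ _ F `|y|) fs => //.
- by move=> u v; rewrite /F linearBl.
- by move=> u; rewrite /F mulrC dot_cauchy_schwarz.
Qed.

(** The scalar product with [b i] is continuous and may be taken term by term; a single term
    survives. *)
Lemma has_sum_coord (a : I -> RorC R k) (s : H) :
  has_sum (fun i => a i *: b i) s -> forall i, dot s (b i) = a i.
Proof.
move=> /has_sum_dot as_ i; apply: has_sum_unique (as_ (b i)) _.
rewrite -[a i](_ : \sum_(j <- [fset i]%fset) dot (a j *: b j) (b i) = _).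
  apply: has_sum_finite => j; rewrite inE => /negPf ji.
  by rewrite dotZl dot_basis ji mulr0.
by rewrite big_seq_fset1 dotZl dot_basis eqxx mulr1.
Qed.

Lemma sqr_norm_sum_basis (a : I -> RorC R k) (J : {fset I}) :
  `|\sum_(i <- J) a i *: b i| ^+ 2 = \sum_(i <- J) `|a i| ^+ 2.
Proof.
rewrite hnorm /ip linear_sumlz /= big_seq [RHS]big_seq.
apply: eq_bigr => i iJ /=.
rewrite dotZl linear_sumr /= (big_fsetD1 i) //= dotZr.
rewrite dot_basis eqxx mulr1 big_seq big1 ?addr0 ?normCKs // => j.
rewrite in_fsetD1 => /andP[/negPf ji _].
by rewrite dotZr dot_basis eq_sym ji mulr0.
Qed.

End HilbertSpace.

(** The squared norm of a finite tail is a difference of two partial sums of |a i|^2, each within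
    e^2 / 2 of their sum. *)
Lemma riesz_fischer {R : realType} {k : scalar_kind}
    {H : completeNormedModType (RorC R k)} (dot : {dot H for (@sconj R k)})
    (hnorm : forall x : H, `|x| ^+ 2 = ip dot x x)
    {I : choiceType} {b : I -> H} (hb : orthonormal_basis dot b)
    (a : I -> RorC R k) :
  ell2 a -> has_sum (fun i => a i *: b i) (unordered_sum (fun i => a i *: b i)).
Proof.
case=> s /has_sumP as_; apply: cauchy_has_sum => e e0.
have [|J0 hJ] := as_ (e ^+ 2 / 2); first by rewrite divr_gt0 ?exprn_gt0.
exists J0 => J sJ; rewrite -(@ltr_pXn2r _ 2) ?nnegrE // ?ltW //.
rewrite (sqr_norm_sum_basis hnorm hb) -partial_sumB //.
rewrite -[ltLHS]ger0_norm; last first.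
  by rewrite partial_sumB // sumr_ge0 // => i _; rewrite exprn_ge0.
rewrite [e ^+ 2]splitr (le_lt_trans (ler_distD s _ _)) //.
by rewrite ltrD ?hJ // distrC hJ.
Qed.



(** * Integer powers of a graph, and the symmetry of the orbit sequence *)

Section IntegerPowers.
Context {V : Type} {A : set (V * V)}.

(** A bi-infinite orbit realizes all powers at once; membership in the powers of U_1 is obtained in
    this way. *)
Lemma op_pow_orbit (z : int -> V) : (forall M, A (z M, z (M + 1))) ->
  forall N M, op_pow A N (z M, z (M + N)).
Proof.
move=> zA [n|n] M.
  elim: n => [|n IHn] /=; first by rewrite addr0.
  by exists (z (M + n%:Z)) => //=; rewrite -addn1 PoszD addrA; exact: zA.
rewrite NegzE.
suff h m : op_pow A (- m%:Z) (z M, z (M - m%:Z)) by exact: h.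
case: m => [|m]; first by rewrite oppr0 addr0.
rewrite -NegzE /= NegzE.
elim: m => [|m [y yM Ay]] /=.
  by exists (z M) => //=; rewrite -{2}[M](subrK 1); exact: zA.
exists (z (M - m.+1%:Z)); first by exists y.
rewrite /=; have := zA (M - m.+2%:Z); congr (A (_, z _)).
by rewrite -[in m.+2]addn1 PoszD opprD addrA subrK.
Qed.

(* Pitfall: [(A \; B)%relation] applies [B] first, then [A]. *)
Lemma op_pow_ind (D : int -> set (V * V)) :
  (forall x, D 0 (x, x)) ->
  (forall N x y z, D N (x, y) -> A (y, z) -> D (N + 1) (x, z)) ->
  (forall N x y z, D N (x, y) -> A (z, y) -> D (N - 1) (x, z)) ->
  forall N, op_pow A N `<=` D N.
Proof.
move=> D0 DS DP [n|n] [x z] /=.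
  elim: n z => [z e|n IHn z [y /= /IHn Dxy Ayz]].
    by have {}e : x = z := e; rewrite -e.
  by rewrite -addn1 PoszD; exact: DS Dxy Ayz.
elim: n z => [|n IHn] z /= [y /= + Azy].
  move=> e; have {}e : x = y := e; rewrite -e in Azy; rewrite -[Negz 0]add0r; 
  exact: DP (D0 _) Azy.
move=> /= Dxy; rewrite NegzE -addn1 PoszD opprD -NegzE.
by apply: (DP _ _ y) => //; apply: IHn.
Qed.

Lemma iter_functional (n : nat) (x y z : V) :
  (forall x y z, A (x, y) -> A (x, z) -> y = z) ->
  iter n (fun B => (A \; B)%relation) diagonal (x, y) ->
  iter n (fun B => (A \; B)%relation) diagonal (x, z) -> y = z.
Proof.
move=> Af; elim: n y z => [y z xy xz|n IHn y z [y' /= hy Ay] [z' /= hz Az]].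
  exact: etrans (esym (xy : x = y)) (xz : x = z).
by move: Az; rewrite -(IHn _ _ hy hz); exact: Af.
Qed.

End IntegerPowers.

(** Negative powers iterate the converse graph, which is functional by injectivity. *)
Lemma op_pow_functional {V : Type} (A : set (V * V)) N x y z :
  (forall x y z, A (x, y) -> A (x, z) -> y = z) -> op_injective A ->
  op_pow A N (x, y) -> op_pow A N (x, z) -> y = z.
Proof.
move=> Af Ai; case: N => n; first exact: iter_functional.
by apply: (@iter_functional _ (A^-1)%relation n.+1) => u v w; exact: Ai.
Qed.

Lemma app_unique {K : numFieldType} {V W : lmodType K} (A : set (V * W)) x y :
  A (x, y) -> (forall z, A (x, z) -> z = y) -> app A x = y.
Proof. exact: xget_unique. Qed.

(** Applying U_0^N to both entries turns {x_0, U_0^(-N) x_0} into {U_0^N x_0, x_0}, the conjugate of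
    {x_0, U_0^N x_0} by Hermitian symmetry. *)
Lemma orbit_ip_opp {R : realType} {k : scalar_kind} {H0 : lmodType (RorC R k)}
    (form0 : {hermitian H0 for false & (@sconj R k)}) (U0 : set (H0 * H0))
    (x0 : H0) (N : int) :
  unitary_on_orbit form0 U0 x0 ->
  ip form0 x0 (app (op_pow U0 (- N)) x0) =
  sconj (ip form0 x0 (app (op_pow U0 N) x0)).
Proof.
case=> -[_ _ Uf] Ui Udom Uip; pose z M := app (op_pow U0 M) x0.
have zP M : op_pow U0 M (x0, z M) by exact: xgetPex (Udom M).
have zE M x : op_pow U0 M (x0, x) -> x = z M.
  by move=> h; exact: (op_pow_functional Uf Ui h (zP M)).
have z0 : z 0 = x0 by rewrite -(zE 0 x0).
have zS M : U0 (z M, z (M + 1)).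
  case: M => [n|n].
    have := zP (n%:Z + 1); rewrite -PoszD addn1 /= => -[y hy /=].
    by rewrite (zE n y hy).
  have [y hy /=] := zP (Negz n).
  suff -> : y = z (Negz n + 1) by [].
  (* From [Negz 0] the orbit moves to [z 0 = x0], which is no longer a negative power. *)
  case: n hy => [|n] hy; first by rewrite -(hy : x0 = y) -[LHS]z0.
  rewrite [LHS](zE (Negz n) y hy); congr (z _).
  by rewrite !NegzE -[in RHS]addn1 PoszD opprD subrK.
have appU M : app U0 (z M) = z (M + 1).
  by apply: app_unique (zS M) _ => y Uy; exact: Uf Uy (zS M).
have span M : lin_span (fun N => app (op_pow U0 N) x0) (z M).
  exact: (mem_lin_span z).
have shift i j : form0 (z (i + 1)) (z (j + 1)) = form0 (z i) (z j).
  by have [+ _] := Uip _ _ (span j) (span i); rewrite !appU.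
have shiftn (i j : int) (n : nat) :
    form0 (z (i + n)) (z (j + n)) = form0 (z i) (z j).
  elim: n => [|n IHn]; first by rewrite !addr0.
  by rewrite intS [1 + _]addrC !addrA shift IHn.
have opp (n : nat) : form0 (z (- n%:Z)) (z 0) = sconj (form0 (z n) (z 0)).
  rewrite -(shiftn _ _ n) addNr add0r [LHS](hermC form0).
  by rewrite expr0 mul1r.
rewrite /ip -/(z _) -/(z _) -z0; case: (intP N) => [|n|n].
- by rewrite oppr0 [LHS](hermC form0) expr0 mul1r.
- exact: opp.
- by rewrite opprK opp sconjK.
Qed.



(** * The weighted shift, its inverse adjoint, and the powers of their direct sum *)

Lemma norm_fst {K : numFieldType} {V W : normedModType K} (p : V * W) :
  `|p.1| <= `|p|.
Proof.
by rewrite prod_normE comparable_le_max ?lexx // real_comparable // normr_real.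
Qed.

Lemma norm_snd {K : numFieldType} {V W : normedModType K} (p : V * W) :
  `|p.2| <= `|p|.
Proof.
rewrite prod_normE comparable_le_max ?lexx ?orbT //.
by rewrite real_comparable // normr_real.
Qed.

Lemma divf_chain {F : fieldType} (x y z : F) :
  y != 0 -> x / y * (y / z) = x / z.
Proof. by move=> y0; rewrite mulrA divfK. Qed.

Section WeightedShift.
Context {R : realType} {k : scalar_kind} {H : normedModType (RorC R k)}.
Context (dot : {dot H for (@sconj R k)}).
Hypothesis hnorm : forall x : H, `|x| ^+ 2 = ip dot x x.
Context (b : int -> H).
Hypothesis hb : orthonormal_basis dot b.
Context (u : int -> RorC R k).
Hypothesis u0 : forall n, u n != 0.

Local Notation K := (RorC R k).

(** The relation is linear and continuous in [p], so it need only hold on the generators of the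
    closed graph. Choices of [x] and [y] yield the coordinates of the shift and membership in its
    adjoint. *)
Lemma wshift_dot (x y : H) :
  (forall n, u (n + 1) / u n * dot (b (n + 1)) x = dot (b n) y) ->
  forall p, wshift b u p -> dot p.2 x = dot p.1 y.
Proof.
move=> xy p pA; apply/subr0_eq.
pose F (q : H * H) : K^o := dot q.2 x - dot q.1 y.
apply: (@closure_additive_eq0 _ _ _ F (`|x| + `|y|)) pA => //.
- by move=> q r; rewrite /F !linearBl !opprD addrACA.
- move=> q; rewrite (le_trans (ler_normB _ _)) // mulrDl lerD //.
    rewrite (le_trans (dot_cauchy_schwarz hnorm _ _)) // mulrC.
    by rewrite ler_wpM2l ?norm_snd.
  rewrite (le_trans (dot_cauchy_schwarz hnorm _ _)) // mulrC.
  by rewrite ler_wpM2l ?norm_fst.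
move=> _ [J [a ->]]; rewrite /F.
have -> : (\sum_(i <- J) a i *: (b i, (u (i + 1) / u i) *: b (i + 1))).1 =
   \sum_(i <- J) a i *: b i by rewrite raddf_sum.
have -> : (\sum_(i <- J) a i *: (b i, (u (i + 1) / u i) *: b (i + 1))).2 =
   \sum_(i <- J) a i *: ((u (i + 1) / u i) *: b (i + 1)) by rewrite raddf_sum.
rewrite !linear_sumlz -sumrB big1 // => n _ /=.
by rewrite !dotZl xy subrr.
Qed.

Lemma wshift_coord p n : wshift b u p ->
  dot p.2 (b (n + 1)) = u (n + 1) / u n * dot p.1 (b n).
Proof.
pose w := u (n + 1) / u n.
move=> /(@wshift_dot (b (n + 1)) (sconj w *: b n)) ->.
  by rewrite dotZr sconjK.
move=> m; rewrite dotZr sconjK !(dot_basis hb) (inj_eq (addIr 1)).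
by case: eqVneq => [->|]; rewrite ?mulr1 ?mulr0.
Qed.

Lemma wshift_basis n : wshift b u (b n, (u (n + 1) / u n) *: b (n + 1)).
Proof. by apply: subset_closure; exact: (mem_lin_span _ n). Qed.

(** Testing on the generators gives one relation per coordinate, and [wshift_dot] gives the
    converse: the adjoint is the backward weighted shift on its maximal domain. *)
Lemma adjoint_wshiftP x y : adjoint dot (wshift b u) (x, y) <->
  forall n, dot y (b n) = sconj (u (n + 1) / u n) * dot x (b (n + 1)).
Proof.
split=> [xy n|xy s t st].
  have := xy _ _ (@wshift_basis n); rewrite /ip /= dotZl => e.
  by rewrite dotC -e rmorphM /= -dotC.
apply: (@wshift_dot x y _ (s, t)) st => n.
by rewrite [RHS]dotC xy rmorphM /= sconjK -dotC.
Qed.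

Lemma submod_wshift : submod_set (wshift b u).
Proof. by apply: submod_closure; exact: submod_lin_span. Qed.

(* The maximal coordinatewise graph of U_1^N. It is functional but may be
   strictly larger than [op_pow U_1 N]: the iterated powers require all the
   intermediate vectors to exist. *)
Definition shift_graph (N : int) : set ((H * H) * (H * H)) :=
  [set p | forall n,
    dot p.2.1 (b (n + N)) = u (n + N) / u n * dot p.1.1 (b n)
    /\ dot p.2.2 (b (n + N)) = sconj (u n / u (n + N)) * dot p.1.2 (b n)].

Lemma shift_graph_functional N x y z :
  shift_graph N (x, y) -> shift_graph N (x, z) -> y = z.
Proof.
case: y z => [y1 y2] [z1 z2] hy hz; congr (_, _);
  apply: (coord_inj hnorm hb) => n; have := hy (n - N); have := hz (n - N);
  rewrite subrK /=.
- by case=> -> _ [-> _].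
- by case=> _ -> [_ ->].
Qed.

(** Inverting the adjoint inverts its nonzero weights, so the second component is still governed by
    coordinates alone. *)
Lemma double_shiftP p : double_shift dot b u p <->
  wshift b u (p.1.1, p.2.1) /\
  forall n, dot p.2.2 (b (n + 1)) = sconj (u n / u (n + 1)) * dot p.1.2 (b n).
Proof.
rewrite /double_shift /op_dsum /=.
have su n : sconj (u n) != 0 by rewrite fmorph_eq0.
split=> -[h1 h2]; split=> //.
  move=> n; move/adjoint_wshiftP: h2 => ->.
  by rewrite mulrA -rmorphM /= mulrA divfK // divff // rmorph1 mul1r.
apply/adjoint_wshiftP => n; rewrite h2.
by rewrite mulrA -rmorphM /= mulrA divfK // divff // rmorph1 mul1r.
Qed.

Lemma double_shift_graph : double_shift dot b u `<=` shift_graph 1.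
Proof.
by move=> p /double_shiftP[h1 h2] n; split; [exact: wshift_coord h1|exact: h2].
Qed.

Lemma double_shift_operator : is_operator (double_shift dot b u).
Proof.
have [w0 wP] := submod_wshift.
split.
- by apply/double_shiftP; split=> // n; rewrite !linear0l mulr0.
- move=> a p q /double_shiftP[p1 p2] /double_shiftP[q1 q2].
  apply/double_shiftP; split=> [|n]; first exact: wP p1 q1.
  by rewrite /= !linearPl /= p2 q2 mulrDr mulrCA.
- move=> x y z /double_shift_graph xy /double_shift_graph.
  exact: shift_graph_functional xy.
Qed.

Lemma double_shift_injective : op_injective (double_shift dot b u).
Proof.
move=> [x1 x2] [y1 y2] z /double_shift_graph xz /double_shift_graph yz.
congr (_, _); apply: (coord_inj hnorm hb) => n;
  have [/= ex1 ex2] := xz n; have [/= ey1 ey2] := yz n.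
- apply: (@mulfI _ (u (n + 1) / u n)); first by rewrite mulf_neq0 ?invr_eq0.
  by rewrite -ex1 -ey1.
- apply: (@mulfI _ (sconj (u n / u (n + 1)))); last by rewrite -ex2 -ey2.
  by rewrite fmorph_eq0 mulf_neq0 ?invr_eq0.
Qed.

(** The weights of successive steps telescope; a backward step cancels the nonzero weight of the
    forward one. *)
Lemma op_pow_double_shift N :
  op_pow (double_shift dot b u) N `<=` shift_graph N.
Proof.
apply: op_pow_ind => {N} [x n|N x y z xy|N x y z xy].
- by rewrite addr0 divff // rmorph1 !mul1r.
- move=> /double_shift_graph yz n; have [/= e1 e2] := xy n.
  have [/= f1 f2] := yz (n + N); rewrite addrA f1 f2 e1 e2.
  split; rewrite mulrA; first by rewrite divf_chain.
  by rewrite -rmorphM /= [X in sconj X]mulrC divf_chain.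
- move=> /double_shift_graph zy n; have [/= e1 e2] := xy n.
  have [/=] := zy (n + N - 1); rewrite subrK -addrA e1 e2 => f1 f2.
  split.
    apply: (@mulfI _ (u (n + N) / u (n + (N - 1)))).
      by rewrite mulf_neq0 ?invr_eq0.
    by rewrite -f1 mulrA divf_chain.
  apply: (@mulfI _ (sconj (u (n + (N - 1)) / u (n + N)))).
    by rewrite fmorph_eq0 mulf_neq0 ?invr_eq0.
  by rewrite -f2 mulrA -rmorphM /= [_ / _ * (_ / _)]mulrC divf_chain.
Qed.

(** The vectors u_M b_M form an orbit of the shift, and any [g] with the right coordinates completes
    a multiple of it to an orbit of U_1. Both the basis vectors and x_1 lie on such orbits. *)
Lemma op_pow_double_shift_orbit (a : K) (g : int -> H) :
  (forall M n, dot (g (M + 1)) (b (n + 1)) =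
    sconj (u n / u (n + 1)) * dot (g M) (b n)) ->
  forall N M, op_pow (double_shift dot b u) N
    (((a * u M) *: b M, g M), ((a * u (M + N)) *: b (M + N), g (M + N))).
Proof.
move=> gS N M.
apply: (@op_pow_orbit _ _ (fun M => ((a * u M) *: b M, g M))) => {}M.
apply/double_shiftP; split=> /= [|n]; last exact: gS.
have [w0 wP] := submod_wshift.
have := wP (a * u M) _ _ (@wshift_basis M) w0; rewrite addr0.
by rewrite -[_ *: (_, _)]/(_, _) /= scalerA -mulrA [u M * _]mulrC divfK.
Qed.

Lemma op_pow_app N x y : op_pow (double_shift dot b u) N (x, y) ->
  app (op_pow (double_shift dot b u) N) x = y.
Proof.
move=> xy; apply: app_unique (xy) _ => z /op_pow_double_shift xz.
exact: shift_graph_functional xz (op_pow_double_shift xy).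
Qed.

Lemma op_pow_double_shift_inl N n : op_pow (double_shift dot b u) N
  ((b n, 0), ((u (n + N) / u n) *: b (n + N), 0)).
Proof.
have := @op_pow_double_shift_orbit (u n)^-1 (fun=> 0) _ N n.
rewrite mulVf // scale1r [_^-1 * _]mulrC; apply => M m.
by rewrite !linear0l mulr0.
Qed.

Lemma op_pow_double_shift_inr N n : op_pow (double_shift dot b u) N
  ((0, b n), (0, sconj (u n / u (n + N)) *: b (n + N))).
Proof.
have := @op_pow_double_shift_orbit 0 (fun M => sconj (u n / u M) *: b M) _ N n.
rewrite !mul0r !scale0r divff // rmorph1 scale1r; apply => M m.
rewrite !dotZl !(dot_basis hb) (inj_eq (addIr 1)).
case: eqVneq => [->|]; rewrite ?mulr0 // !mulr1 -rmorphM /=.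
by rewrite [_ / _ * (_ / _)]mulrC divf_chain.
Qed.

End WeightedShift.



(** * Summability by comparison with a geometric series *)

Section GeometricDomination.

(** The indices lie in an interval [M, M + d), over which the geometric sum telescopes. *)
Lemma sum_half_powers {K : numFieldType} (s : seq nat) (M : nat) :
  uniq s -> (forall j, j \in s -> (M <= j)%N) ->
  \sum_(j <- s) (2 ^+ j)^-1 <= 2 / 2 ^+ M :> K.
Proof.
move=> us sM.
have geom d : \sum_(M <= j < M + d) (2 ^+ j)^-1
    = 2 / 2 ^+ M - 2 / 2 ^+ (M + d) :> K.
  elim: d => [|d IHd]; first by rewrite addn0 subrr big_geq.
  rewrite addnS big_nat_recr ?leq_addr //= IHd exprS invfM mulrA divff //.
  rewrite mul1r -addrA; congr (_ + _).
  by rewrite mulr2n mulrDl !mul1r opprD subrK.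
pose d := \max_(j <- s) j.+1.
have sub j : j \in s -> j \in index_iota M (M + d).
  move=> js; rewrite mem_index_iota sM //= (@leq_trans d) ?leq_addl //.
  exact: (@leq_bigmax_seq _ _ xpredT (fun j => j.+1)).
have -> : \sum_(j <- s) (2 ^+ j)^-1
    = \sum_(M <= j < M + d | j \in s) (2 ^+ j)^-1 :> K.
  rewrite -[RHS]big_filter; apply: perm_big; apply: uniq_perm => //.
    by rewrite filter_uniq // iota_uniq.
  by move=> j; rewrite mem_filter; apply/esym/andb_idr => /sub.
apply: (@le_trans _ _ (\sum_(M <= j < M + d) (2 ^+ j)^-1)).
  rewrite [leRHS](bigID (mem s)) /= lerDl sumr_ge0 //.
by rewrite geom gerBl divr_ge0 // exprn_ge0.
Qed.

(** Outside [F] and the indices coded below [M], the norms add up to at most 2 / 2^M. *)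
Lemma dominated_has_sum {R : realType} {k : scalar_kind} {I : countType}
    {V : completeNormedModType (RorC R k)} (f : I -> V) (F : {fset I}) :
  (forall i, i \notin F -> `|f i| <= (2 ^+ choice.pickle i)^-1) ->
  has_sum f (unordered_sum f).
Proof.
move=> fF; apply: cauchy_has_sum => e e0.
have [|M Me] := @archi_lt1 _ _ (e / 2); first by rewrite divr_gt0.
pose J0 : {fset I} := [fset i in pmap choice.unpickle (iota 0 M)]%fset.
have mJ0 i : (choice.pickle i < M)%N -> i \in J0.
  move=> iM; rewrite inE /= mem_pmap; apply/mapP.
  by exists (choice.pickle i); rewrite ?choice.pickleK // mem_iota.
exists (F `|` J0)%fset => J _.
apply: (@le_lt_trans _ _ (2 / 2 ^+ M)); last first.
  by rewrite mulrC -ltr_pdivlMr.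
apply: le_trans (ler_norm_sum _ _ _) _.
have := @sum_half_powers (RorC R k)
  (map choice.pickle (J `\` (F `|` J0))%fset) M.
rewrite big_map => sum_le; apply: le_trans (sum_le _ _).
- rewrite big_seq [leRHS]big_seq; apply: ler_sum => i.
  by rewrite !inE negb_or => /andP[/andP[/fF]].
- by rewrite map_inj_uniq ?fset_uniq //; exact: (pcan_inj (@choice.pickleK I)).
- move=> _ /mapP[i + ->]; rewrite 2!inE negb_or -andbA => /and3P[_ + _].
  by rewrite leqNgt; apply: contra => /mJ0.
Qed.

(* [RorC R k] has no declared completeness structure: the sum is computed on the
   line spanned by the unit vector [v], inside the complete space [H]. *)
Lemma dominated_ell2 {R : realType} {k : scalar_kind} {I : countType}
    {H : completeNormedModType (RorC R k)} (dot : {dot H for (@sconj R k)})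
    (hnorm : forall x : H, `|x| ^+ 2 = ip dot x x) (v : H) (a : I -> RorC R k) :
  `|v| = 1 -> (forall i, `|a i| <= (2 ^+ choice.pickle i)^-1) -> ell2 a.
Proof.
move=> v1 ha; pose f i := `|a i| ^+ 2 *: v.
have /(@has_sum_dot _ _ _ _ hnorm _ _ _ v) : has_sum f (unordered_sum f).
  apply: (@dominated_has_sum _ _ _ _ _ fset0) => i _.
  rewrite normrZ v1 mulr1 normrX normr_id expr2 -[leRHS]mulr1.
  apply: ler_pM => //; rewrite (le_trans (ha i)) // invf_le1 ?exprn_gt0 //.
  by rewrite exprn_ege1 // ler1n.
set s : RorC R k := dot _ _ => fs; exists s.
suff -> : (fun i => `|a i| ^+ 2 : (RorC R k)^o) = fun i => dot (f i) v by [].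
apply/funext => i; rewrite /f dotZl -[dot v v]/(ip dot v v) -hnorm v1.
by rewrite expr1n mulr1.
Qed.

End GeometricDomination.

(** * Weights growing fast enough to dominate the translates of the orbit sequence *)

Definition int_ball (r : nat) : {fset int} :=
  ([fset n in map Posz (iota 0 r)]
     `|` [fset n in map (fun i => - i%:Z) (iota 0 r)])%fset.

Lemma mem_int_ball r n : (`|n| < r)%N -> n \in int_ball r.
Proof.
move=> nr; rewrite !inE /=; apply/orP; case: (intP n) nr => [|i|i] nr.
- by left; apply: map_f; rewrite mem_iota.
- by left; apply: map_f; rewrite mem_iota.
- right; apply: (map_f (fun i => - i%:Z)).
  by rewrite mem_iota; rewrite abszN in nr.
Qed.

Section FastWeights.
Context {R : realType} {k : scalar_kind} (c : int -> RorC R k).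

(* The window |i| <= 2|n| contains n - M as soon as |n| >= |M|, so that every
   translate of [c] is eventually dominated by the weights, which puts f_0 in
   the domain of all the powers. Pickling both n and -n keeps the weights even. *)
Definition fast_weight (n : int) : RorC R k :=
  1 + 2 ^+ (choice.pickle n + choice.pickle (- n))
      * \sum_(i <- int_ball (2 * `|n|).+1) `|c i|.

Lemma fast_weight_gt0 n : 0 < fast_weight n.
Proof. by rewrite ltr_wpDr // mulr_ge0 ?exprn_ge0 // sumr_ge0. Qed.

Lemma fast_weightN n : fast_weight (- n) = fast_weight n.
Proof. by rewrite /fast_weight abszN opprK addnC. Qed.

Lemma sconj_fast_weight n : sconj (fast_weight n) = fast_weight n.
Proof. exact/sconj_ge0/ltW/fast_weight_gt0. Qed.

(** |c m| occurs in the window sum; one power of 2 gives the bound, the other is at least 1. *)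
Lemma fast_weight_dominates m n : (`|m| <= 2 * `|n|)%N ->
  `|c m| / fast_weight n <= (2 ^+ choice.pickle n)^-1.
Proof.
move=> mn; rewrite ler_pdivrMr ?fast_weight_gt0 // mulrC.
rewrite ler_pdivlMr ?exprn_gt0 //.
rewrite /fast_weight ler_wpDl // exprD mulrC -mulrA ler_wpM2l ?exprn_ge0 //.
rewrite (big_fsetD1 m) /=; last by apply: mem_int_ball; rewrite ltnS.
rewrite -[leLHS]mul1r ler_pM //.
  by rewrite exprn_ege1 // ler1n.
by rewrite lerDl sumr_ge0.
Qed.

End FastWeights.



(** * The vector f_0 and the evaluation of {x_1, U_1^N x_1}_1 *)

Lemma ell2_f0_coef {R : realType} {k : scalar_kind} (c u : int -> RorC R k) :
  ell2 (fun N => (u N)^-1 * c N) -> ell2 (f0_coef c u).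
Proof.
(* Conjugation preserves moduli, so |f_0(N)|^2 is [r] times |c(N) / u_N|^2. *)
case=> s hs; pose r : RorC R k := `|2^-1 * sconj (u 0)| ^+ 2.
have r0 : 0 <= r by rewrite exprn_ge0.
pose F (x : (RorC R k)^o) : (RorC R k)^o := r * x.
exists (F s); suff -> : (fun i => `|f0_coef c u i| ^+ 2 : (RorC R k)^o) =
    F \o (fun N => `|(u N)^-1 * c N| ^+ 2).
  apply: (@has_sum_bounded_additive _ _ _ _ F r) hs => //.
  - by move=> x y; rewrite /F mulrBr.
  - by move=> x; rewrite /F normrM ger0_norm.
apply/funext => N; rewrite /F /r /= /f0_coef -exprMn; congr (_ ^+ 2).
by rewrite !normrM !normfV !norm_sconj !mulrA.
Qed.

Section Coefficients.
Context {R : realType} {k : scalar_kind} {H : completeNormedModType (RorC R k)}.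
Context (dot : {dot H for (@sconj R k)}).
Hypothesis hnorm : forall x : H, `|x| ^+ 2 = ip dot x x.
Context (b : int -> H).
Hypothesis hb : orthonormal_basis dot b.
Context (c : int -> RorC R k).
Hypothesis cN : forall N, c (- N) = sconj (c N).

Lemma fast_weight_admissible : admissible_weights c (fast_weight c).
Proof.
split=> [n|n|]; first by rewrite gt_eqF ?fast_weight_gt0.
- by rewrite fast_weightN sconj_fast_weight.
- apply: (dominated_ell2 hnorm (norm_basis hnorm hb 0)) => n.
  rewrite normrM normfV (gtr0_norm (fast_weight_gt0 c n)) mulrC.
  by apply: fast_weight_dominates; rewrite leq_pmull.
Qed.

Lemma f0_vec_coord u : admissible_weights c u ->
  forall n, dot (f0_vec b c u) (b n) = f0_coef c u n.
Proof.
case=> _ _ /ell2_f0_coef cu; apply: (has_sum_coord hnorm hb).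
exact: (riesz_fischer hnorm hb cu).
Qed.

(** An explicit orbit through x_1 is built; its second halves [g M] exist for every M by
    domination. *)
Lemma fast_weight_domain N : let u := fast_weight c in
  dom (op_pow (double_shift dot b u) N) (b 0, f0_vec b c u).
Proof.
move=> u; have u0 n : u n != 0 by rewrite gt_eqF ?fast_weight_gt0.
(* Up to the factor put into [g], these are the components of the second half of U_1^M x_1: the
   shift weight at j - M cancels the one in f_0(j - M). *)
pose h M j := (sconj (c (j - M)) / u j) *: b j.
have hs M : has_sum (h M) (unordered_sum (h M)).
  apply: (@dominated_has_sum _ _ _ _ _ (int_ball `|M|)) => j jM.
  rewrite normrZ (norm_basis hnorm hb) mulr1 normrM normfV norm_sconj.
  rewrite (gtr0_norm (fast_weight_gt0 c j)); apply: fast_weight_dominates.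
  have: (`|M| <= `|j|)%N.
    by rewrite leqNgt; apply: contra jM; exact: mem_int_ball.
  lia.
have hc M j : dot (unordered_sum (h M)) (b j) = sconj (c (j - M)) / u j.
  exact: (has_sum_coord hnorm hb (hs M)).
pose g M := (2^-1 * sconj (u 0)) *: unordered_sum (h M).
have g0 : g 0 = f0_vec b c u.
  apply: (coord_inj hnorm hb) => n.
  rewrite f0_vec_coord ?dotZl ?hc ?subr0; last exact: fast_weight_admissible.
  rewrite /f0_coef -/u [sconj (u n)]sconj_fast_weight -/u.
  by rewrite -!mulrA; congr (_ * (_ * _)); rewrite mulrC.
(* The factor [(u 0)^-1] makes b_0 the first half at time 0. *)
have := @op_pow_double_shift_orbit _ _ _ _ hnorm b _ u0 (u 0)^-1 g _ N 0.
rewrite mulVf // scale1r g0 => xy; eexists; apply: xy => M n.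
rewrite /g !dotZl !hc [sconj (u n / _)]rmorphM /= fmorphV /=.
rewrite [sconj (u n)]sconj_fast_weight [sconj (u (n + 1))]sconj_fast_weight -/u.
have -> : n + 1 - (M + 1) = n - M by rewrite opprD addrACA subrr addr0.
by rewrite [RHS]mulrCA; congr (_ * _); rewrite [RHS]mulrC divf_chain.
Qed.

Context (u : int -> RorC R k).
Hypothesis cu : admissible_weights c u.

Let u0 n : u n != 0. Proof. by have [] := cu. Qed.
Let uN n : sconj (u (- n)) = u n. Proof. by have [] := cu. Qed.

(** This is the term (f_0, U^N b_0), in which the weights cancel. *)
Lemma f0_coef_pos N : u N / u 0 * sconj (f0_coef c u N) = c N / 2.
Proof.
rewrite /f0_coef !rmorphM /= !fmorphV /= rmorph_nat !sconjK.
by rewrite mulrA mulrCA divf_chain // divff // mulr1 mulrC.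
Qed.

(** This is the term (b_0, V^N f_0), with V the inverse of the adjoint of U; [cN] turns conj c(-N)
    into c(N). *)
Lemma f0_coef_neg N : sconj (u (- N) / u 0) * f0_coef c u (- N) = c N / 2.
Proof.
rewrite /f0_coef rmorphM /= fmorphV /= cN sconjK.
by rewrite mulrA mulrCA divf_chain ?divff ?fmorph_eq0 // mulr1 mulrC.
Qed.

(** Two indices contribute: [inl 0], as x_1 has first half b_0, and [inr (- N)], as b_n in the
    second summand is sent to a multiple of b_(n+N), which is paired with b_0. *)
Lemma cross_ip_basis_sum N :
  cross_ip_via_basis dot b (op_pow (double_shift dot b u) N)
    (b 0, f0_vec b c u) (c N).
Proof.
split=> [[n|n]|].
- by eexists; exact: op_pow_double_shift_inl.
- by eexists; exact: op_pow_double_shift_inr.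
set f := (X in has_sum X _).
have fl n : f (inl n) = (n == 0)%:R * (c N / 2).
  have := op_pow_double_shift_inl hnorm b u0 N n.
  rewrite /f /= => /(op_pow_app hnorm hb u0) ->.
  rewrite /dsum_ip /cross_ip /ip /= linear0l linear0r !dotZl addr0 add0r.
  rewrite (dot_basis hb) dotC f0_vec_coord // eq_sym.
  by case: eqVneq => [->|]; rewrite ?mul0r // add0r f0_coef_pos.
have fr n : f (inr n) = (n == - N)%:R * (c N / 2).
  have := op_pow_double_shift_inr hnorm hb u0 N n.
  rewrite /f /= => /(op_pow_app hnorm hb u0) ->.
  rewrite /dsum_ip /cross_ip /ip /= !linear0l linear0r !dotZl add0r addr0.
  rewrite (dot_basis hb) f0_vec_coord // -addr_eq0.
  case: eqVneq => [nN|]; rewrite ?mulr0 ?mul0r // mulr1 mul1r mulrC nN.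
  by rewrite (eqP (_ : n == - N)) ?f0_coef_neg // -addr_eq0 nN.
(* The two indices are distinct even for N = 0, so the halves add up. *)
have -> : c N = \sum_(i <- [fset inl 0; inr (- N)]%fset) f i.
  rewrite big_fsetU1 ?inE //= big_seq_fset1 fl fr !eqxx !mul1r.
  by rewrite -splitr.
apply: has_sum_finite => -[n|n]; rewrite !inE ?orbF => nn.
- by rewrite fl; case: (eqVneq n 0) nn => [->|]; rewrite ?eqxx ?mul0r.
- by rewrite fr; case: (eqVneq n (- N)) nn => [->|]; rewrite ?eqxx ?mul0r.
Qed.

(** On the domain, coordinates identify the first half of the value as (u_N / u_0) b_N, and only the
    b_0-coordinate of the second half enters. *)
Lemma cross_ip_app N :
  dom (op_pow (double_shift dot b u) N) (b 0, f0_vec b c u) ->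
  cross_ip dot (b 0, f0_vec b c u)
    (app (op_pow (double_shift dot b u) N) (b 0, f0_vec b c u)) = c N.
Proof.
case=> -[x y] xy; rewrite (op_pow_app hnorm hb u0 xy).
have gr := op_pow_double_shift hnorm hb u0 xy.
have -> : x = (u N / u 0) *: b N.
  apply: (coord_inj hnorm hb) => n; have [/= + _] := gr (n - N).
  rewrite subrK => ->; rewrite dotZl !(dot_basis hb) eq_sym subr_eq0 eq_sym.
  by case: eqVneq => [->|]; rewrite ?subrr // !mulr0.
rewrite /cross_ip /ip /= dotZl [dot (b N) _]dotC f0_vec_coord // f0_coef_pos.
have [/= _] := gr (- N); rewrite addNr f0_vec_coord // f0_coef_neg => ->.
by rewrite -splitr.
Qed.

End Coefficients.

Theorem theorem3p1 (R : realType) (k : scalar_kind)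
    (H0 : lmodType (RorC R k))
    (form0 : {hermitian H0 for false & (@sconj R k)})
    (U0 : set (H0 * H0)) (x0 : H0)
    (hU0 : unitary_on_orbit form0 U0 x0)
    (H : completeNormedModType (RorC R k))
    (dot : {dot H for (@sconj R k)})
    (hnorm : forall x : H, `|x| ^+ 2 = ip dot x x)
    (b : int -> H) (hb : orthonormal_basis dot b) :
  let c := fun N : int => ip form0 x0 (app (op_pow U0 N) x0) in
  let U1 := fun u : int -> RorC R k => double_shift dot b u in
  let x1 := fun u : int -> RorC R k => (b 0, f0_vec b c u) in
  (exists u, admissible_weights c u
     /\ forall N, dom (op_pow (U1 u) N) (x1 u))
  /\ forall u, admissible_weights c u ->
     [/\ ell2 (f0_coef c u),
         has_sum (fun n : int => f0_coef c u n *: b n) (f0_vec b c u),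
         is_operator (U1 u) /\ op_injective (U1 u)
       & forall N : int,
         cross_ip_via_basis dot b (op_pow (U1 u) N) (x1 u) (c N)
         /\ (dom (op_pow (U1 u) N) (x1 u) ->
             cross_ip dot (x1 u) (app (op_pow (U1 u) N) (x1 u)) = c N)].
Proof.
move=> c U1 x1.
have cN N : c (- N) = sconj (c N) by exact: orbit_ip_opp.
split.
  (* These weights also put x_1 in the domain of every power, so the conditional identity below has
     instances. *)
  exists (fast_weight c); split; first exact: (fast_weight_admissible hnorm hb).
  exact: (fast_weight_domain hnorm hb).
move=> u cu; have [u0 _ /ell2_f0_coef f0] := cu.
split=> //; first exact: (riesz_fischer hnorm hb).
  split; first exact: (double_shift_operator hnorm hb u0).
  exact: (double_shift_injective hnorm hb u0).
move=> N; split; first exact: (cross_ip_basis_sum hnorm hb cN cu).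
exact: (cross_ip_app hnorm hb cN cu).
Qed.
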